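(* Let $f(u,v)\in\mathbb{C}[u,v]$ be an irreducible polynomial of degree $n$ whose zero set $X=\mathbf{V}(f)\subset\mathbb{C}^2$ is not a line through the origin. For each $k\in\{1,\dots,n\}$, the set $S_f(k)\cup\{(0,0,0)\}\subset\mathbb{R}^3$ is star-shaped with base point $(0,0,0)$.
   Context: $B\subset\mathbb{R}^3$ is the open ball of radius $\frac12$ centered at $(\frac12,0,0)$, i.e. $B=\{(x,y,z): x-x^2-y^2-z^2>0\}$. For $\mathbf{p}=(x,y,z)\in B$ and $\lambda\in\mathbb{C}$, $\beta(\mathbf{p},\lambda)=\left(\frac{x\lambda}{\sqrt{x-x^2-y^2-z^2}},\frac{(y+iz)\lambda}{\sqrt{x-x^2-y^2-z^2}}\right)\in\mathbb{C}^2$. $N_f(\mathbf{p})$ is the number of zeros, counted with multiplicity, of the polynomial $\lambda\mapsto f(\beta(\mathbf{p},\lambda))$ in the open unit disk $|\lambda|<1$ (this polynomial is not identically zero since $X$ is not a line through the origin). For $k\in\{1,\dots,n\}$, $S_f(k)=\{\mathbf{p}\in B:N_f(\mathbf{p})<k\}$. A set $S\subset\mathbb{R}^m$ is star-shaped with base point $\mathbf{p}\in S$ if for every $\mathbf{q}\in S$ the line segment joining $\mathbf{p}$ to $\mathbf{q}$ is contained in $S$. *)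

(* Defs.v *)
From HB Require Import structures.
From mathcomp Require Import all_boot all_order all_algebra.
From mathcomp Require Import complex mpoly.
From mathcomp Require Import classical_sets reals.
From mathcomp Require Import lra.

Set Implicit Arguments.
Unset Strict Implicit.
Unset Printing Implicit Defensive.

Import Order.TTheory GRing.Theory Num.Theory.

Local Open Scope classical_set_scope.
Local Open Scope complex_scope.
Local Open Scope ring_scope.

Definition irreducible_elt (A : idomainType) (a : A) : Prop :=
  [/\ a != 0, a \isn't a GRing.unit &
      forall b c : A, a = b * c -> b \is a GRing.unit \/ c \is a GRing.unit].

Definition star_shaped (R : realType) (m : nat) (S : set 'rV[R]_m)
    (p : 'rV[R]_m) : Prop :=
  S p /\ forall q, S q ->
    forall t : R, 0 <= t <= 1 -> S ((1 - t) *: p + t *: q).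

Definition zero_set (R : realType) (f : {mpoly R[i][2]}) : set 'rV[R[i]]_2 :=
  [set v | f.@[v 0] = 0].

Definition line_through_origin (R : realType) (X : set 'rV[R[i]]_2) : Prop :=
  exists2 w : 'rV[R[i]]_2, w != 0 & X = [set v | exists c : R[i], v = c *: w].

(* A point (x, y, z) of R^3 is p : 'rV[R]_3, with x = p 0 0, y = p 0 1 and
   z = p 0 2. *)
Definition ball_fun (R : realType) (p : 'rV[R]_3) : R :=
  p 0 0 - p 0 0 ^+ 2 - p 0 1 ^+ 2 - p 0 2 ^+ 2.

Definition B (R : realType) : set 'rV[R]_3 := [set p | 0 < ball_fun p].

(* The Euclidean norm is written out because the library norm on row vectors
   is the sup norm. *)
Lemma B_ball (R : realType) (p : 'rV[R]_3) :
  B p <-> Num.sqrt ((p 0 0 - 2^-1) ^+ 2 + p 0 1 ^+ 2 + p 0 2 ^+ 2) < 2^-1.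
Proof.
have h0 : 0 < 2^-1 :> R by rewrite invr_gt0 ltr0n.
rewrite -[X in _ < X](ger0_norm (ltW h0)) -sqrtr_sqr ltr_sqrt ?exprn_gt0 //.
by rewrite /B /ball_fun /=; split; lra.
Qed.

Definition beta (R : realType) (p : 'rV[R]_3) (lam : R[i]) : 'rV[R[i]]_2 :=
  \row_(i < 2) ((if i == 0 then (p 0 0)%:C else p 0 1 +i* p 0 2) * lam
                / (Num.sqrt (ball_fun p))%:C).

(* The polynomial lam |-> f (beta p lam), as an element of {poly R[i]}; since
   beta p lam = lam *: beta p 1, each variable is replaced by the
   corresponding coordinate of beta p 1 times 'X. *)
Definition slice (R : realType) (f : {mpoly R[i][2]}) (p : 'rV[R]_3) :
    {poly R[i]} :=
  mmap polyC (fun i => beta p 1 0 i *: 'X) f.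

Lemma horner_slice (R : realType) (f : {mpoly R[i][2]}) (p : 'rV[R]_3)
    (lam : R[i]) : (slice f p).[lam] = f.@[beta p lam 0].
Proof.
rewrite /slice /meval /mmap horner_sum; apply: eq_bigr => m _.
rewrite hornerM hornerC; congr (_ * _).
rewrite /mmap1 horner_prod; apply: eq_bigr => i _.
by rewrite horner_exp hornerZ hornerX !mxE mulr1 mulrAC.
Qed.

(* The distinct roots of P; an arbitrary sequence when P = 0. *)
Definition roots_of (F : closedFieldType) (P : {poly F}) : seq F :=
  undup (sval (closed_field_poly_normal P)).

Lemma mem_roots_of (F : closedFieldType) (P : {poly F}) (a : F) :
  P != 0 -> (a \in roots_of P) = root P a.
Proof.
rewrite /roots_of mem_undup; case: closed_field_poly_normal => r /= {2}-> P0.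
by rewrite rootZ ?lead_coef_eq0 // root_prod_XsubC.
Qed.

Definition num_disk_zeros (R : realType) (f : {mpoly R[i][2]})
    (p : 'rV[R]_3) : nat :=
  \sum_(a <- roots_of (slice f p) | `|a| < 1) mup a (slice f p).

Definition S_set (R : realType) (f : {mpoly R[i][2]}) (k : nat) :
    set 'rV[R]_3 :=
  [set p | B p /\ (num_disk_zeros f p < k)%N].

(* Main.v *)
Require Import Defs.
From mathcomp Require Import all_boot all_order all_algebra.
From mathcomp Require Import complex mpoly.
From mathcomp Require Import classical_sets reals.
From mathcomp Require Import ring lra.

Import Order.TTheory GRing.Theory Num.Theory.

Local Open Scope classical_set_scope.
Local Open Scope complex_scope.
Local Open Scope ring_scope.

(** For p in the ball and 0 < t <= 1, the point t p is again in the ball and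
    beta (t p) lam = beta p (c lam) with
    c ^ 2 = t (x - |p|^2) / (x - t |p|^2), so that 0 < c <= 1.  Hence the zeros
    of the slice at t p are those of the slice at p divided by c, and no more
    of them lie in the unit disk. *)

Lemma comp_poly_scaleX_eq0 (F : fieldType) (c : F) (g : {poly F}) :
  c != 0 -> (g \Po (c *: 'X) == 0) = (g == 0).
Proof.
by move=> c0; rewrite comp_poly_eq0 // size_scale // size_polyX.
Qed.

(** Substituting [c^-1 *: 'X] undoes the scaling and turns ['X - a%:P] into a nonzero multiple of
    ['X - (c * a)%:P], so divisibility by powers carries over to [g]. *)
Lemma mup_comp_scaleX (F : fieldType) (c a : F) (g : {poly F}) :
  c != 0 -> g != 0 -> (mup a (g \Po (c *: 'X)) <= mup (c * a) g)%N.
Proof.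
move=> c0 g0; have h0 : g \Po (c *: 'X) != 0 by rewrite comp_poly_scaleX_eq0.
have gK : (g \Po (c *: 'X)) \Po (c^-1 *: 'X) = g.
  by rewrite -comp_polyA comp_polyZ comp_polyX scalerA divff // scale1r comp_polyXr.
rewrite mup_geq // -[X in _ %| X]gK.
have := leqnn (mup a (g \Po (c *: 'X))); rewrite {1}mup_geq //.
move=> /(dvdp_comp_poly (c^-1 *: 'X)); apply: dvdp_trans.
rewrite rmorphXn /= comp_polyB comp_polyX comp_polyC.
have -> : c^-1 *: 'X - a%:P = c^-1 *: ('X - (c * a)%:P).
  by rewrite scalerBr -mul_polyC -mul_polyC -polyCM mulKf.
by rewrite exprZn dvdpZr // expf_neq0 // invr_eq0.
Qed.

Lemma sum_mup_disk_comp_scaleX (C : numClosedFieldType) (c : C) (g : {poly C}) :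
  0 < c <= 1 ->
  (\sum_(a <- roots_of (g \Po (c *: 'X)) | (`|a| < 1)%R) mup a (g \Po (c *: 'X))
   <= \sum_(b <- roots_of g | (`|b| < 1)%R) mup b g)%N.
Proof.
case/andP=> c_gt0 c_le1; have c0 := lt0r_neq0 c_gt0.
(* [roots_of 0] is arbitrary, but here both sums are literally the same. *)
have [->|g0] := eqVneq g 0; first by rewrite comp_poly0.
set h := g \Po _; have h0 : h != 0 by rewrite comp_poly_scaleX_eq0.
(* Both lists are duplicate-free, so comparing their members suffices: [a] is a root of [h] iff
   [c * a] is one of [g]. *)
have rootsE : perm_eq [seq c * a | a <- roots_of h] (roots_of g).
  apply: uniq_perm; rewrite ?map_inj_uniq ?undup_uniq //; first exact: mulfI.
  move=> b; rewrite -[b](mulVKf c0) mem_map; last exact: mulfI.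
  by rewrite !mem_roots_of // root_comp !hornerE.
rewrite -(perm_big _ rootsE) big_map /=.
apply: (@leq_trans (\sum_(a <- roots_of h | (`|a| < 1)%R) mup (c * a) g)).
  by apply: leq_sum => a _; exact: mup_comp_scaleX.
(* Since [c <= 1], multiplication by [c] keeps the unit disk inside itself, so the right-hand filter
   keeps every term the left one keeps. *)
rewrite [leqLHS]big_mkcond [leqRHS]big_mkcond; apply: leq_sum => a _.
case: ifP => // a1; rewrite normrM (gtr0_norm c_gt0).
by rewrite (le_lt_trans _ a1) // ler_piMl.
Qed.

Lemma slice_comp_scaleX (R : realType) (f : {mpoly R[i][2]})
    (p q : 'rV[R]_3) (c : R[i]) :
  beta q 1 = c *: beta p 1 -> slice f q = slice f p \Po (c *: 'X).
Proof.
move=> qE; rewrite /slice qE /mmap raddf_sum /=; apply: eq_bigr => m _.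
rewrite comp_polyM comp_polyC; congr (_ * _).
rewrite /mmap1 rmorph_prod /=; apply: eq_bigr => i _.
by rewrite rmorphXn /= comp_polyZ comp_polyX !mxE scalerA [c * _]mulrC.
Qed.

(** The difference of the two sides is [t * (1 - t) * x], and [x] is positive on the ball because it
    exceeds the squared norm of [p]. *)
Lemma ball_fun_scale (R : realType) (p : 'rV[R]_3) (t : R) :
  B p -> 0 < t <= 1 -> t * t * ball_fun p <= ball_fun (t *: p) /\ B (t *: p).
Proof.
rewrite /B /ball_fun /= !mxE => Bp /andP[t0 t1].
set x := p 0 0 in Bp *; set y := p 0 1 in Bp *; set z := p 0 2 in Bp *.
have s0 : 0 <= x ^+ 2 + y ^+ 2 + z ^+ 2 by rewrite !addr_ge0 ?sqr_ge0.
have x0 : 0 <= t * (1 - t) * x by rewrite !mulr_ge0 ?subr_ge0 // ?ltW //; lra.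
have d0 := mulr_gt0 (mulr_gt0 t0 t0) Bp.
by split; lra.
Qed.

Lemma beta_scale (R : realType) (p : 'rV[R]_3) (t : R) :
  B p -> 0 < t <= 1 ->
  exists2 c : R, 0 < c <= 1 & beta (t *: p) 1 = c%:C *: beta p 1.
Proof.
move=> Bp t01; have [tB Btp] := ball_fun_scale R p t Bp t01.
case/andP: t01 => t0 _.
set r := Num.sqrt (ball_fun p); set s := Num.sqrt (ball_fun (t *: p)).
have r0 : 0 < r by rewrite sqrtr_gt0.
have s0 : 0 < s by rewrite sqrtr_gt0.
(* The numerators of [beta] gain the factor [t], while the denominator changes from [r] to [s]. *)
exists (t * r / s).
  rewrite divr_gt0 ?mulr_gt0 //= ler_pdivrMr // mul1r.
  (* Writing [t * r] as the root of its square reduces [t * r <= s] to the inequality [tB]. *)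
  rewrite -[t * r]gtr0_norm ?mulr_gt0 // -sqrtr_sqr ler_wsqrtr //.
  by rewrite exprMn sqr_sqrtr ?expr2 // ltW.
apply/rowP => i; rewrite !mxE -/r -/s !mulr1.
have rC0 : r%:C != 0 by rewrite (inj_eq (@complexI R)) gt_eqF.
have sC0 : s%:C != 0 by rewrite (inj_eq (@complexI R)) gt_eqF.
have -> : (if i == 0 then (t * p 0 0)%:C else (t * p 0 1) +i* (t * p 0 2))
  = t%:C * (if i == 0 then (p 0 0)%:C else p 0 1 +i* p 0 2).
  by case: ifP => _; simpc.
rewrite !rmorphM /= fmorphV.
by field; rewrite rC0 sC0.
Qed.

Lemma num_disk_zeros_scale (R : realType) (f : {mpoly R[i][2]})
    (p : 'rV[R]_3) (t : R) :
  B p -> 0 < t <= 1 ->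
  (num_disk_zeros f (t *: p) <= num_disk_zeros f p)%N.
Proof.
move=> Bp t01; have [c c01 /slice_comp_scaleX sE] := beta_scale R p t Bp t01.
rewrite /num_disk_zeros sE; apply: sum_mup_disk_comp_scaleX.
by rewrite ltcR lecR.
Qed.

Theorem corollary3p10 (R : realType) (n : nat) (f : {mpoly R[i][2]})
    (f_irr : irreducible_elt f)
    (f_deg : msize f = n.+1)
    (X_not_line : ~ line_through_origin (zero_set f))
    (k : nat) (k_range : (1 <= k <= n)%N) :
  star_shaped (S_set f k `|` [set 0]) 0.
Proof.
split=> [|q Sq t /andP[t_ge0 t_le1]]; first by right.
rewrite scaler0 add0r; case: Sq => [[Bq Nq]|->]; last by right; rewrite scaler0.
(* The endpoint [t = 0] is the origin, which lies on the boundary of the ball and is covered by the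
   added singleton. *)
have [->|t0] := eqVneq t 0; first by right; rewrite scale0r.
have t01 : 0 < t <= 1 by rewrite lt0r t0 t_ge0.
left; split; first by have [] := ball_fun_scale R q t Bq t01.
exact: leq_ltn_trans (num_disk_zeros_scale R f q t Bq t01) Nq.
Qed.
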